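(* Let $L$ be a regular language. If $\mathrm{sc}(L)=n$, then $\mathrm{sc}(\mathrm{root}(L))\le n^n$.
   Context: For a language $L\subseteq\Sigma^*$ over a finite alphabet $\Sigma$, $\mathrm{root}(L)=\{w\in\Sigma^* : \exists n\ge 1 \text{ such that } w^n\in L\}$. The state complexity $\mathrm{sc}(L)$ of a regular language $L\subseteq\Sigma^*$ is the number of states of the smallest DFA over $\Sigma$ (with total transition function) recognizing $L$. *)

(* Defs.v *)
From mathcomp Require Import all_boot.

Set Implicit Arguments.
Unset Strict Implicit.
Unset Printing Implicit Defensive.

Definition word (Sigma : finType) := seq Sigma.

Definition language (Sigma : finType) := word Sigma -> Prop.

Record dfa (Sigma : finType) := DFA {
  dfa_state : finType;
  dfa_start : dfa_state;
  dfa_final : {set dfa_state};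
  dfa_trans : dfa_state -> Sigma -> dfa_state
}.

Definition dfa_accepts (Sigma : finType) (A : dfa Sigma) (w : word Sigma) : bool :=
  foldl (@dfa_trans Sigma A) (dfa_start A) w \in dfa_final A.

Definition recognizes (Sigma : finType) (A : dfa Sigma) (L : language Sigma) : Prop :=
  forall w : word Sigma, dfa_accepts A w <-> L w.

Definition regular (Sigma : finType) (L : language Sigma) : Prop :=
  exists A : dfa Sigma, recognizes A L.

(* [is_sc L n] reads "sc(L) = n".  State complexity is a relation because it
   has a value only when L is regular; the value is unique when it exists. *)
Definition is_sc (Sigma : finType) (L : language Sigma) (n : nat) : Prop :=
  (exists A : dfa Sigma, recognizes A L /\ #|dfa_state A| = n) /\
  (forall A : dfa Sigma, recognizes A L -> n <= #|dfa_state A|).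

Definition word_pow (Sigma : finType) (w : word Sigma) (n : nat) : word Sigma :=
  flatten (nseq n w).

Definition lang_root (Sigma : finType) (L : language Sigma) : language Sigma :=
  fun w => exists n : nat, 1 <= n /\ L (word_pow w n).

(* Main.v *)
(** A word [w] acts on the states of a DFA for [L] by a transformation [f_w],
    and [w] lies in the root of [L] iff the forward orbit of [f_w q0] meets the
    final states. So membership depends only on [f_w], and a DFA whose states
    are the [n ^ n] transformations of an [n]-element set can compute it. *)
Require Import Defs.
From mathcomp Require Import all_boot.
From Stdlib Require Import Classical.

(** [P] need not be decidable, so excluded middle drives the descent. *)
Lemma least_nat (P : nat -> Prop) (n : nat) :
  P n -> exists m, [/\ P m, m <= n & forall k, P k -> m <= k].
Proof.
elim/ltn_ind: n => n IHn Pn.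
have [[k [lt_kn Pk]]|least_n] := classic (exists k, k < n /\ P k).
  have [m [Pm le_mk least_m]] := IHn k lt_kn Pk.
  by exists m; split=> //; apply: leq_trans le_mk (ltnW lt_kn).
exists n; split=> // k Pk; rewrite leqNgt; apply/negP=> lt_kn.
by apply: least_n; exists k.
Qed.

(** Reduces an upper bound on state complexity to exhibiting one DFA. *)
Lemma is_sc_le (Sigma : finType) (L : language Sigma) (A : dfa Sigma) :
  recognizes A L -> exists m, is_sc L m /\ m <= #|dfa_state A|.
Proof.
move=> recA.
have [|m [[B recB] le_mA least_m]] := @least_nat
  (fun k => exists B : dfa Sigma, recognizes B L /\ #|dfa_state B| = k)
  #|dfa_state A|; first by exists A.
exists m; split=> //; split; first by exists B.
by move=> C recC; apply: least_m; exists C.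
Qed.

Lemma foldl_word_pow (Sigma : finType) (Q : Type) (d : Q -> Sigma -> Q)
    (q : Q) (w : word Sigma) (k : nat) :
  foldl d q (word_pow w k) = iter k (fun p => foldl d p w) q.
Proof.
elim: k q => [|k IHk] q //; rewrite iterSr -IHk.
by rewrite /word_pow /= foldl_cat.
Qed.

Section RootAutomaton.

Variables (Sigma : finType) (A : dfa Sigma).
Local Notation Q := (dfa_state A).

(** The orbit starts at [f (dfa_start A)], not at [dfa_start A], because the exponent in [lang_root]
    is at least 1. *)
Definition root_dfa : dfa Sigma :=
  @DFA Sigma {ffun Q -> Q} [ffun q => q]
    [set f : {ffun Q -> Q} |
      [exists q in dfa_final A, fconnect f (f (dfa_start A)) q]]
    (fun f a => [ffun q => dfa_trans (f q) a]).

Lemma root_dfa_run (w : word Sigma) (q : Q) :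
  (foldl (@dfa_trans _ root_dfa) (dfa_start root_dfa) w : {ffun Q -> Q}) q
    = foldl (@dfa_trans _ A) q w.
Proof.
(* Letters act by post-composition, hence induction from the right. *)
elim/last_ind: w => [|w a IHw]; first by rewrite ffunE.
by rewrite !foldl_rcons -IHw ffunE.
Qed.

Lemma root_dfa_recognizes (L : language Sigma) :
  recognizes A L -> recognizes root_dfa (lang_root L).
Proof.
move=> recA w; rewrite /dfa_accepts inE.
set f := foldl _ _ w.
have iter_f k q : iter k f q = foldl (@dfa_trans _ A) q (word_pow w k).
  by rewrite foldl_word_pow; apply: eq_iter => p; apply: root_dfa_run.
split=> [/exists_inP[q Fq /iter_findex def_q] | [[|k] [] // _ /recA Lwk]].
  (* [findex] counts steps from [f (dfa_start A)]; the successor adds the step leading there. *)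
  exists (findex f (f (dfa_start A)) q).+1; split=> //; apply/recA.
  by rewrite /dfa_accepts -iter_f iterSr def_q.
apply/exists_inP; exists (iter k.+1 f (dfa_start A)).
  by rewrite iter_f.
by rewrite iterSr fconnect_iter.
Qed.

End RootAutomaton.

Theorem corollary1p2 (Sigma : finType) (L : language Sigma) (n : nat) :
  regular L -> is_sc L n ->
  exists m : nat, is_sc (lang_root L) m /\ m <= n ^ n.
Proof.
move=> _ [[A [recA <-]] _].
have [m [sc_m le_m]] := is_sc_le _ _ _ (root_dfa_recognizes _ _ _ recA).
by exists m; split=> //; rewrite -card_ffun.
Qed.
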